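(* Let $A$ be a very nice (real or complex) Banach algebra. Then for each $a\in L(A)$, the component of $L(A)$ containing $a$ coincides with the component of $I(A)$ containing $a$.
   Context: Algebras are real or complex associative algebras, not assumed unital. $I(A)$ is the set of all idempotents of $A$. $L(A) := \{ a \in A : axay = axy \ \text{for all } x,y \in A\}$ is the set of endomorphic left elements of $A$. An algebra $A$ is very nice if and only if every $a\in A$ satisfying $axy = axay$ for all $x,y\in A$ also satisfies $a\in I(A)$ and $ax = axa$ for all $x\in A$. Components are connected components, with $L(A)$ and $I(A)$ carrying the relative norm topology. *)

(* Defs.v *)
From HB Require Import structures.
From mathcomp Require Import all_boot all_order all_algebra.
From mathcomp Require Import all_classical all_reals all_analysis.
From mathcomp Require Import complex.

Set Implicit Arguments.
Unset Strict Implicit.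
Unset Printing Implicit Defensive.

Import Order.TTheory GRing.Theory Num.Theory.
Import numFieldNormedType.Exports.

Local Open Scope classical_set_scope.
Local Open Scope ring_scope.

(* MathComp's [algType] is unital, so the not necessarily unital case needs its
   own structure. *)
HB.mixin Record Lmodule_isNonUnitalAlgebra (K : fieldType) A
    of GRing.Lmodule K A := {
  amul : A -> A -> A;
  amulA : associative amul;
  amulDl : left_distributive amul +%R;
  amulDr : right_distributive amul +%R;
  amulZl : forall (k : K) (x y : A), amul (k *: x) y = k *: amul x y;
  amulZr : forall (k : K) (x y : A), amul x (k *: y) = k *: amul x y
}.

#[short(type="nonUnitalAlgType")]
HB.structure Definition NonUnitalAlgebra (K : fieldType) :=
  {A of GRing.Lmodule K A & Lmodule_isNonUnitalAlgebra K A}.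

Notation "x ** y" := (amul x y) (at level 40, left associativity) : ring_scope.

HB.mixin Record NonUnitalAlgebra_isBanach (K : numFieldType) A
    of CompleteNormedModule K A & NonUnitalAlgebra K A := {
  ler_norm_amul : forall x y : A, `|amul x y| <= `|x| * `|y|
}.

(* The norm of a [normedModType K] is [K]-valued, so for [K = R[i]] it takes
   values in the nonnegative (hence real) elements of [R[i]]. *)
#[short(type="banachAlgType")]
HB.structure Definition BanachAlgebra (K : numFieldType) :=
  {A of CompleteNormedModule K A & NonUnitalAlgebra K A
      & NonUnitalAlgebra_isBanach K A}.

Definition idempotents (K : fieldType) (A : nonUnitalAlgType K) : set A :=
  [set a | a ** a = a].
Arguments idempotents {K} A.

Definition endo_left (K : fieldType) (A : nonUnitalAlgType K) : set A :=
  [set a | forall x y : A, a ** x ** a ** y = a ** x ** y].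
Arguments endo_left {K} A.

Definition very_nice (K : fieldType) (A : nonUnitalAlgType K) : Prop :=
  forall a : A,
    (forall x y : A, a ** x ** y = a ** x ** a ** y) ->
    idempotents A a /\ (forall x : A, a ** x = a ** x ** a).
Arguments very_nice {K} A.

(* Main.v *)
Require Import Defs.
From mathcomp Require Import all_boot all_order all_algebra.
From mathcomp Require Import all_classical all_reals all_analysis.
From mathcomp Require Import complex.

(** Very niceness says exactly that an endomorphic left element is an idempotent
    [a] with [a x = a x a] for all [x], so [L(A)] is a subset of [I(A)], and it
    suffices to show that [L(A)] is open and closed in [I(A)]: a connected set of
    idempotents that meets [L(A)] then stays inside it.

    The identity [a x = a x a] passes from an idempotent [e] to every idempotent
    [f] near it.  In a unital algebra this is because nearby idempotents are
    conjugate.  As [A] may lack a unit, a direct estimate replaces conjugation: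
    [z = f x - f x f] satisfies [f z = z] and [z f = 0], while [e z = e z e];
    hence [z = (f - e) z + e z (e - f)], so that
    [|z| <= |e - f| (1 + |e|) |z|], which forces [z = 0] once
    [|e - f| (1 + |e|) < 1] ([semicentral_near]).  Since the radius depends on [e]
    in a locally bounded way, the roles of [e] and [f] can be exchanged, which
    yields openness and closedness at once ([endo_left_near]).  All of this works
    over any scalar field with a norm, in particular over the real and the complex
    numbers. *)

Set Implicit Arguments.
Unset Strict Implicit.
Unset Printing Implicit Defensive.

Import Order.TTheory GRing.Theory Num.Theory.
Import numFieldNormedType.Exports.

Local Open Scope classical_set_scope.
Local Open Scope ring_scope.

Lemma amulBl (K : fieldType) (A : nonUnitalAlgType K) (x y z : A) :
  (x - y) ** z = x ** z - y ** z.
Proof. by rewrite amulDl -!scaleN1r amulZl. Qed.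

Lemma amulBr (K : fieldType) (A : nonUnitalAlgType K) (x y z : A) :
  z ** (x - y) = z ** x - z ** y.
Proof. by rewrite amulDr -!scaleN1r amulZr. Qed.

Lemma amulr0 (K : fieldType) (A : nonUnitalAlgType K) (x : A) : x ** 0 = 0.
Proof. by rewrite -(subrr x) amulBr !subrr. Qed.

Lemma connected_locally_constant (T : topologicalType) (C P : set T) (a : T) :
  connected C -> C a -> P a ->
  (forall x, C x -> \forall y \near x, C y -> (P x <-> P y)) ->
  C `<=` P.
Proof.
move=> Cconn Ca Pa loc.
have -> : C = C `&` P; last exact: subIsetr.
apply/esym/Cconn; first by exists a.
(* The points of [C] near which [C] lies in [P] form the trace on [C] of an
   interior; likewise for the complement of [P]. *)
- exists (~` C `|` P)°; first exact: open_interior.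
  rewrite eqEsubset; split=> x [Cx].
    move=> Px; split=> //; near=> y.
    have [Cy|nCy] := pselect (C y); last by left.
    by right; apply/(near (loc x Cx) y).
  by move=> /interior_subset [].
- exists (~` (~` C `|` ~` P)°).
    exact/open_closedC/open_interior.
  rewrite eqEsubset; split=> x [Cx].
    by move=> Px; split=> // /interior_subset [].
  move=> nint; split=> //; apply: contrapT => nPx; apply: nint.
  near=> y.
  have [Cy|nCy] := pselect (C y); last by left.
  by right=> Py; apply/nPx/(near (loc x Cx) y).
Unshelve. all: by end_near. Qed.

Section SemicentralIdempotents.
Context {K : numFieldType} {A : banachAlgType K}.

(** The constant [1 + |e|] comes from the two error terms [(f - e) z] and
    [e z (e - f)] for the defect [z = f x - f x f]. *)
Lemma semicentral_near (e f : A) :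
  idempotents A f -> `|e - f| * (1 + `|e|) < 1 ->
  (forall x, e ** x = e ** x ** e) -> forall x, f ** x = f ** x ** f.
Proof.
move=> ff close esc x; apply/eqP; rewrite -subr_eq0; set z := _ - _.
have fz : f ** z = z by rewrite amulBr !amulA ff.
have zf : z ** f = 0 by rewrite amulBl -[_ ** f ** f]amulA ff subrr.
clearbody z.
have zE : z = (f - e) ** z + e ** z ** (e - f).
  by rewrite amulBl amulBr fz -esc -(amulA e z f) zf amulr0 subr0 subrK.
have zle : `|z| <= `|e - f| * (1 + `|e|) * `|z|.
  rewrite {1}zE (le_trans (ler_normD _ _))// mulrDr mulr1 mulrDl lerD//.
    by rewrite (distrC e) ler_norm_amul.
  rewrite (le_trans (ler_norm_amul _ _))// -mulrA mulrC ler_wpM2l//.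
  exact: ler_norm_amul.
rewrite -normr_le0 -(@pmulr_rle0 _ (1 - `|e - f| * (1 + `|e|))) ?subr_gt0//.
by rewrite mulrBl mul1r subr_le0.
Qed.

Lemma semicentral_endo_left (f : A) :
  (forall x, f ** x = f ** x ** f) -> endo_left A f.
Proof. by move=> fsc x y; rewrite -fsc. Qed.

Hypothesis niceA : very_nice A.

Lemma endo_left_semicentral (a : A) : endo_left A a ->
  idempotents A a /\ forall x, a ** x = a ** x ** a.
Proof. by move=> La; apply: niceA => x y; rewrite La. Qed.

(** The equivalence is what makes [L(A)] clopen in [I(A)]; it needs a radius
    that serves both directions of [semicentral_near]. *)
Lemma endo_left_near (e : A) : idempotents A e ->
  \forall f \near e, idempotents A f -> (endo_left A e <-> endo_left A f).
Proof.
move=> ee; have c0 : 0 < 2 + `|e| by rewrite ltr_wpDr.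
near=> f => ff.
have close : `|e - f| < (2 + `|e|)^-1.
  by near: f; apply: cvgr_dist_lt; rewrite ?invr_gt0.
have lt1 : `|e - f| * (2 + `|e|) < 1 by rewrite -ltr_pdivlMr// mul1r.
have le_e : 1 + `|e| <= 2 + `|e| by rewrite lerD2r ler1n.
(* The 2 leaves room for the bound [|f| <= |e| + 1]. *)
have le_f : 1 + `|f| <= 2 + `|e|.
  rewrite -[2]/(1 + 1) -addrA lerD2l -{1}(subrK e f) (le_trans (ler_normD _ _))//.
  rewrite lerD2r distrC (le_trans (ltW close))// invf_le1//.
  by rewrite (le_trans _ le_e)// lerDl.
split=> /endo_left_semicentral[_ sc]; apply: semicentral_endo_left.
  by apply: semicentral_near sc => //; apply: le_lt_trans lt1; rewrite ler_wpM2l.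
apply: semicentral_near sc => //; rewrite distrC.
by apply: le_lt_trans lt1; rewrite ler_wpM2l.
Unshelve. all: by end_near. Qed.

Lemma connected_component_endo_left (a : A) : endo_left A a ->
  connected_component (endo_left A) a = connected_component (idempotents A) a.
Proof.
move=> La; rewrite eqEsubset; split=> x [C [Ca Csub Cconn] Cx]; exists C => //.
  by split=> // y /Csub /endo_left_semicentral[].
split=> //; apply: (connected_locally_constant Cconn Ca La) => e Ce.
by apply: filterS (endo_left_near (Csub _ Ce)) => f near_e /Csub.
Qed.

End SemicentralIdempotents.

Theorem theorem6p1 (R : realType) :
  (forall A : banachAlgType R, very_nice A ->
     forall a : A, endo_left A a ->
       connected_component (endo_left A) a =
       connected_component (idempotents A) a) /\
  (forall A : banachAlgType R[i], very_nice A ->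
     forall a : A, endo_left A a ->
       connected_component (endo_left A) a =
       connected_component (idempotents A) a).
Proof. by split=> A niceA a; exact: connected_component_endo_left. Qed.
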